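(* The variety of $\mathbf{UL}_\omega$-algebras and the variety of $\mathbf{IUL}_\omega$-algebras each have the finite embeddability property.
   Context: A $\mathbf{UL}$-algebra is a structure $\mathcal A=\langle A,\wedge,\vee,\cdot,\to,e,f,\bot,\top\rangle$ satisfying the following. $\langle A,\wedge,\vee,\bot,\top\rangle$ is a bounded lattice. $\langle A,\cdot,e\rangle$ is a commutative monoid. For all $x,y,z$: $xy\le z$ iff $y\le x\to z$. For all $x,y,u,v$: $$\lambda_u((x\vee y)\to x)\vee\lambda_v((x\vee y)\to y)=e,\quad\text{where } \lambda_a(b)=(a\to ba)\wedge e.$$ (Equivalently, it is a bounded semilinear commutative residuated lattice with an extra constant $f$.) Here $f$ is an arbitrary constant. A $\mathbf{UL}_\omega$-algebra is a $\mathbf{UL}$-algebra satisfying $x\to e=x^2\to e$ for all $x$, where $x^2=x\cdot x$. An $\mathbf{IUL}_\omega$-algebra is a $\mathbf{UL}_\omega$-algebra satisfying $\neg\neg x=x$ for all $x$, where $\neg x=x\to f$. Partial subalgebra: given an ordered algebra $\mathcal A$ and a nonempty $B\subseteq A$, the partial subalgebra $\mathcal B$ with domain $B$ carries the restricted order. For each operation $g$, $g^{\mathcal B}(b_1,\dots,b_k)=g^{\mathcal A}(b_1,\dots,b_k)$ if this value lies in $B$, and is undefined otherwise. Partial embedding of $\mathcal B$ into an ordered algebra $\mathcal C$: an injective map $\iota:B\to C$ with $a\le b\iff\iota(a)\le\iota(b)$, and $\iota(g^{\mathcal B}(b_1,\dots,b_k))=g^{\mathcal C}(\iota(b_1),\dots,\iota(b_k))$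 whenever the left side is defined. A class $\mathbf K$ has the finite embeddability property (FEP) if every finite partial subalgebra of any member of $\mathbf K$ can be partially embedded into some finite member of $\mathbf K$. *)

(* Defs.v *)
From Stdlib Require Import List.
Import ListNotations.

Record ULsig := {
  car :> Type;
  meet : car -> car -> car;
  join : car -> car -> car;
  mul  : car -> car -> car;
  imp  : car -> car -> car;
  ue   : car;
  uf   : car;
  ubot : car;
  utop : car
}.

Arguments meet {u} _ _.
Arguments join {u} _ _.
Arguments mul {u} _ _.
Arguments imp {u} _ _.
Arguments ue {u}.
Arguments uf {u}.
Arguments ubot {u}.
Arguments utop {u}.

Definition le {A : ULsig} (x y : A) : Prop := meet x y = x.

Definition lam {A : ULsig} (a b : A) : A := meet (imp a (mul b a)) ue.

Definition neg {A : ULsig} (x : A) : A := imp x uf.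

Definition is_UL (A : ULsig) : Prop :=
  (forall x y z : A, meet x (meet y z) = meet (meet x y) z) /\
  (forall x y z : A, join x (join y z) = join (join x y) z) /\
  (forall x y : A, meet x y = meet y x) /\
  (forall x y : A, join x y = join y x) /\
  (forall x y : A, meet x (join x y) = x) /\
  (forall x y : A, join x (meet x y) = x) /\
  (forall x : A, le ubot x) /\
  (forall x : A, le x utop) /\
  (forall x y z : A, mul x (mul y z) = mul (mul x y) z) /\
  (forall x y : A, mul x y = mul y x) /\
  (forall x : A, mul ue x = x) /\
  (forall x y z : A, le (mul x y) z <-> le y (imp x z)) /\
  (forall x y u v : A,
     join (lam u (imp (join x y) x)) (lam v (imp (join x y) y)) = ue).

Definition is_ULw (A : ULsig) : Prop :=
  is_UL A /\ forall x : A, imp x ue = imp (mul x x) ue.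

Definition is_IULw (A : ULsig) : Prop :=
  is_ULw A /\ forall x : A, neg (neg x) = x.

Definition finite_alg (C : ULsig) : Prop :=
  exists l : list C, forall x : C, In x l.

(* iota : A -> C, restricted to the finite domain B (a list of elements of A),
   is a partial embedding of the partial subalgebra of A with domain B into C. *)
Definition partial_embedding (A : ULsig) (B : list A) (C : ULsig) (iota : A -> C) : Prop :=
  (forall a b, In a B -> In b B -> iota a = iota b -> a = b) /\
  (forall a b, In a B -> In b B -> (le a b <-> le (iota a) (iota b))) /\
  (forall a b, In a B -> In b B -> In (meet a b) B -> iota (meet a b) = meet (iota a) (iota b)) /\
  (forall a b, In a B -> In b B -> In (join a b) B -> iota (join a b) = join (iota a) (iota b)) /\
  (forall a b, In a B -> In b B -> In (mul a b) B -> iota (mul a b) = mul (iota a) (iota b)) /\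
  (forall a b, In a B -> In b B -> In (imp a b) B -> iota (imp a b) = imp (iota a) (iota b)) /\
  (In (@ue A) B -> iota ue = ue) /\
  (In (@uf A) B -> iota uf = uf) /\
  (In (@ubot A) B -> iota ubot = ubot) /\
  (In (@utop A) B -> iota utop = utop).

Definition FEP (K : ULsig -> Prop) : Prop :=
  forall (A : ULsig), K A ->
  forall (B : list A), B <> [] ->
  exists (C : ULsig), K C /\ finite_alg C /\
    exists iota : A -> C, partial_embedding A B C iota.

(* Main.v *)
(** Prime filters separate the points of a semilinear algebra [A], and a prime
    filter [F] makes [x -> y \in F] a total, residuated preorder [R]; so it is
    enough to treat one such preorder and one pair of points at a time and to
    take a finite product at the end.

    For a finite [G] containing the given points, let [ev : N^n -> A] enumerate
    the submonoid generated by [G].  The subsets of [N^n] that are intersections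
    of sets [{v | ev v * ev k R b}], [k] in [N^n], [b] in [G], form a chain and
    a UL-algebra, in which [a] in [G] is represented by [{v | ev v R a}].  The
    identity [x -> e = x^2 -> e] passes to it, and so does involutivity when [G]
    is closed under negation.

    The algebra is finite because each [b] yields finitely many sets
    [{v | ev v * ev k R b}].  Otherwise there are sequences [k_i], [m_i] such
    that [ev m_i * ev k_j R b] is equivalent to [j <= i], or to [i < j], for all
    [i], [j]; by a Dickson argument each coordinate may be taken constant or
    strictly increasing.  The identity [x -> e = x^2 -> e] says that [ev d R e]
    depends only on the support of [d], and this contradicts the behaviour of
    the first three terms of the two sequences. *)

From Stdlib Require Import List Arith Lia.
From Stdlib Require Import Classical ClassicalEpsilon.
From Stdlib Require Import FunctionalExtensionality PropExtensionality.
From mathcomp Require classical_sets.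
Require Import Defs.
Import ListNotations.

Set Bullet Behavior "Strict Subproofs".

(** * Residuated lattices and prime filters *)

Fixpoint pow {A : ULsig} (x : A) (n : nat) : A :=
  match n with 0 => ue | S n => mul x (pow x n) end.

Section Residuated.

Variables (A : ULsig) (HA : is_UL A).
Implicit Types x y z w p q : A.

Lemma meetA x y z : meet x (meet y z) = meet (meet x y) z.
Proof. apply HA. Qed.

Lemma joinA x y z : join x (join y z) = join (join x y) z.
Proof. apply HA. Qed.

Lemma meetC x y : meet x y = meet y x.
Proof. apply HA. Qed.

Lemma joinC x y : join x y = join y x.
Proof. apply HA. Qed.

Lemma meet_joinK x y : meet x (join x y) = x.
Proof. apply HA. Qed.

Lemma join_meetK x y : join x (meet x y) = x.
Proof. apply HA. Qed.

Lemma bot_le x : le ubot x.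
Proof. apply HA. Qed.

Lemma le_top x : le x utop.
Proof. apply HA. Qed.

Lemma mulA x y z : mul x (mul y z) = mul (mul x y) z.
Proof. apply HA. Qed.

Lemma mulC x y : mul x y = mul y x.
Proof. apply HA. Qed.

Lemma mul1 x : mul ue x = x.
Proof. apply HA. Qed.

Lemma residuation x y z : le (mul x y) z <-> le y (imp x z).
Proof. apply HA. Qed.

Lemma mulx1 x : mul x ue = x.
Proof. rewrite mulC. apply mul1. Qed.

Lemma mulCA x y z : mul x (mul y z) = mul y (mul x z).
Proof. now rewrite !mulA, (mulC x). Qed.

Lemma mulACA x y z w : mul (mul x y) (mul z w) = mul (mul x z) (mul y w).
Proof. now rewrite <- !mulA, (mulCA y). Qed.

Lemma le_refl x : le x x.
Proof.
  unfold le. rewrite <- (join_meetK x x) at 2. apply meet_joinK.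
Qed.

Lemma le_trans y x z : le x y -> le y z -> le x z.
Proof.
  unfold le. intros Hxy Hyz. now rewrite <- Hxy, <- meetA, Hyz.
Qed.

Lemma le_antisym x y : le x y -> le y x -> x = y.
Proof.
  unfold le. intros Hxy Hyx. now rewrite <- Hxy, meetC.
Qed.

Lemma meet_lel x y : le (meet x y) x.
Proof.
  unfold le. rewrite meetC, meetA. now rewrite (le_refl x : meet x x = x).
Qed.

Lemma meet_ler x y : le (meet x y) y.
Proof. rewrite meetC. apply meet_lel. Qed.

Lemma le_meet x y z : le z x -> le z y -> le z (meet x y).
Proof.
  unfold le. intros Hx Hy. now rewrite meetA, Hx.
Qed.

Lemma le_joinl x y : le x (join x y).
Proof. apply meet_joinK. Qed.

Lemma le_joinr x y : le y (join x y).
Proof. rewrite joinC. apply le_joinl. Qed.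

Lemma le_join_eq x y : le x y -> join x y = y.
Proof.
  unfold le. intros H. rewrite <- H, joinC, meetC. apply join_meetK.
Qed.

Lemma join_le x y z : le x z -> le y z -> le (join x y) z.
Proof.
  intros Hx Hy. apply le_join_eq in Hx, Hy.
  unfold le. rewrite <- Hx, <- Hy, joinA. apply meet_joinK.
Qed.

Lemma mul_lel z x y : le x y -> le (mul z x) (mul z y).
Proof.
  intros H. apply residuation. apply le_trans with (1 := H).
  apply residuation, le_refl.
Qed.

Lemma mul_ler z x y : le x y -> le (mul x z) (mul y z).
Proof. rewrite !(mulC _ z). apply mul_lel. Qed.

Lemma mul_le_neg x y : le x ue -> le (mul x y) y.
Proof.
  intros H. rewrite <- (mul1 y) at 2. now apply mul_ler.
Qed.

Lemma imp_mul_le x y : le (mul x (imp x y)) y.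
Proof. apply residuation, le_refl. Qed.

Lemma mul_join_le z x y w :
  le (mul z x) w -> le (mul z y) w -> le (mul z (join x y)) w.
Proof.
  intros Hx Hy. apply residuation, join_le; now apply residuation.
Qed.

Lemma le_imp x y : le ue (imp x y) <-> le x y.
Proof. now rewrite <- residuation, mulx1. Qed.

Lemma imp1 x : imp ue x = x.
Proof.
  apply le_antisym.
  - rewrite <- (mul1 (imp ue x)). apply imp_mul_le.
  - apply residuation. rewrite mul1. apply le_refl.
Qed.

(** The semilinearity identity at u = v = e, where [lam ue b] reduces to [meet b ue]. *)
Lemma prelinear x y :
  join (meet (imp (join x y) x) ue) (meet (imp (join x y) y) ue) = ue.
Proof.
  assert (H : forall u v, join (lam u (imp (join x y) x))
                               (lam v (imp (join x y) y)) = ue)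
    by (intros; apply HA).
  specialize (H ue ue). unfold lam in H. now rewrite !mulx1, !imp1 in H.
Qed.

Lemma pow_add x m n : pow x (m + n) = mul (pow x m) (pow x n).
Proof.
  induction m as [|m IH]; simpl.
  - now rewrite mul1.
  - now rewrite IH, mulA.
Qed.

Lemma pow_neg p n : le p ue -> le (pow p n) ue.
Proof.
  intros Hp. induction n as [|n IH]; simpl.
  - apply le_refl.
  - now apply le_trans with (1 := mul_le_neg p (pow p n) Hp).
Qed.

(** Expand e = (p \/ q)(w \/ q): every term except pw has q as a factor, and since all factors are
    below the unit it lies below q. *)
Lemma coprime_mul p q w :
  le p ue -> le q ue -> le w ue ->
  join p q = ue -> join w q = ue -> join (mul p w) q = ue.
Proof.
  intros Hp Hq Hw Hpq Hwq. apply le_antisym.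
  - apply join_le; [|exact Hq].
    now apply le_trans with (1 := mul_le_neg p w Hp).
  - rewrite <- (mul1 ue). rewrite <- Hpq at 1. rewrite <- Hwq.
    apply mul_join_le; rewrite mulC; apply mul_join_le.
    + rewrite mulC. apply le_joinl.
    + apply le_trans with q; [now apply mul_le_neg | apply le_joinr].
    + rewrite mulC. apply le_trans with q; [now apply mul_le_neg | apply le_joinr].
    + apply le_trans with q; [now apply mul_le_neg | apply le_joinr].
Qed.

Lemma coprime_pow p q n :
  le p ue -> le q ue -> join p q = ue -> join (pow p n) q = ue.
Proof.
  intros Hp Hq Hpq. induction n as [|n IH]; simpl.
  - rewrite joinC. now apply le_join_eq.
  - apply coprime_mul; auto using pow_neg.
Qed.

(** * Deductive filters and the total preorders they induce *)

Definition filter (F : A -> Prop) : Prop :=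
  F ue /\ (forall x y, F x -> le x y -> F y) /\
  (forall x y, F x -> F y -> F (mul x y)) /\ (forall x, F x -> F (meet x ue)).

(** The order of a totally ordered quotient, pulled back to [A] so that no quotient has to be
    formed. *)
Record linear_preorder (R : A -> A -> Prop) : Prop := {
  lp_le : forall x y, le x y -> R x y;
  lp_trans : forall y x z, R x y -> R y z -> R x z;
  lp_total : forall x y, R x y \/ R y x;
  lp_res : forall x y z, R (mul x y) z <-> R y (imp x z);
  lp_meet : forall x y z, R z x -> R z y -> R z (meet x y);
  lp_join : forall x y z, R x z -> R y z -> R (join x y) z
}.

(** The product of the negative parts of [x] and [y] lies in the filter and below both. *)
Lemma filter_meet F x y : filter F -> F x -> F y -> F (meet x y).
Proof.
  intros (_ & Fup & Fmul & Fneg) Hx Hy.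
  apply Fup with (mul (meet x ue) (meet y ue)); [now apply Fmul; apply Fneg|].
  apply le_meet.
  - rewrite mulC. apply le_trans with (meet x ue); [|apply meet_lel].
    apply mul_le_neg, meet_ler.
  - apply le_trans with (meet y ue); [|apply meet_lel].
    apply mul_le_neg, meet_ler.
Qed.

Lemma filter_linear F :
  filter F -> (forall x y, F (imp x y) \/ F (imp y x)) ->
  linear_preorder (fun x y => F (imp x y)).
Proof.
  intros HF Htot. pose proof HF as (F1 & Fup & Fmul & Fneg).
  split; auto.
  - intros x y H. apply Fup with ue; [exact F1 | now apply le_imp].
  - intros y x z Hxy Hyz.
    apply Fup with (mul (imp x y) (imp y z)); [now apply Fmul|].
    apply -> residuation. rewrite mulA.
    apply le_trans with (mul y (imp y z)); [|apply imp_mul_le].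
    apply mul_ler, imp_mul_le.
  - intros x y z.
    enough (E : imp (mul x y) z = imp y (imp x z)) by now rewrite E.
    apply le_antisym.
    + apply -> residuation. apply -> residuation. rewrite mulA. apply imp_mul_le.
    + apply -> residuation. rewrite <- mulA. apply <- residuation. apply imp_mul_le.
  - intros x y z Hx Hy.
    apply Fup with (meet (imp z x) (imp z y)); [now apply filter_meet|].
    apply residuation, le_meet; apply residuation; [apply meet_lel | apply meet_ler].
  - intros x y z Hx Hy.
    apply Fup with (meet (imp x z) (imp y z)); [now apply filter_meet|].
    apply residuation. rewrite mulC.
    apply mul_join_le; rewrite mulC; apply residuation; [apply meet_lel | apply meet_ler].
Qed.

(** This is the filter generated by [F] and [p]. Since [p] and its powers are below the unit, only
    [g] has to be cut down for closure under [meet _ ue]. *)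
Lemma filter_adjoin F p :
  filter F -> le p ue ->
  filter (fun z => exists g n, F g /\ le (mul g (pow p n)) z).
Proof.
  intros (F1 & Fup & Fmul & Fneg) Hp. repeat split.
  - exists ue, 0. split; [exact F1|]. rewrite mul1. apply le_refl.
  - intros x y (g & n & Hg & Hx) Hxy. exists g, n. split; [exact Hg|].
    now apply le_trans with x.
  - intros x y (g & n & Hg & Hx) (h & m & Hh & Hy).
    exists (mul g h), (n + m). split; [now apply Fmul|].
    rewrite pow_add, mulACA.
    apply le_trans with (mul x (mul h (pow p m))).
    + now apply mul_ler.
    + now apply mul_lel.
  - intros x (g & n & Hg & Hx). exists (meet g ue), n. split; [now apply Fneg|].
    apply le_meet.
    + apply le_trans with (2 := Hx). apply mul_ler, meet_lel.
    + apply le_trans with (pow p n); [apply mul_le_neg, meet_ler | now apply pow_neg].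
Qed.

(** If [p] and [q] are both missing, maximality puts [c] into both generated filters: g p^n <= c and
    h q^m <= c with negative g, h in [F]. As p^n \/ q^m = e, the product gh = gh(p^n \/ q^m) is
    below [c], so [c] is in [F]. *)
Lemma maximal_filter_prime F c p q :
  filter F -> ~ F c ->
  (forall F', filter F' -> (forall x, F x -> F' x) -> ~ F' c -> forall x, F' x -> F x) ->
  le p ue -> le q ue -> join p q = ue -> F p \/ F q.
Proof.
  intros HF Hc Hmax Hp Hq Hpq. pose proof HF as (F1 & Fup & Fmul & Fneg).
  assert (adjoin : forall r, le r ue -> ~ F r ->
            exists g n, F g /\ le g ue /\ le (mul g (pow r n)) c).
  { intros r Hr Hnr.
    destruct (classic (exists g n, F g /\ le (mul g (pow r n)) c))
      as [(g & n & Hg & Hgc)|Hno].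
    - exists (meet g ue), n. repeat split; auto using meet_ler.
      apply le_trans with (2 := Hgc). apply mul_ler, meet_lel.
    - exfalso. apply Hnr. refine (Hmax _ (filter_adjoin F r HF Hr) _ Hno r _).
      + intros x Hx. exists x, 0. split; [exact Hx|]. simpl. rewrite mulx1. apply le_refl.
      + exists ue, 1. split; [exact F1|]. simpl. rewrite mulx1, mul1. apply le_refl. }
  destruct (classic (F p)) as [|Np]; [now left|].
  destruct (classic (F q)) as [|Nq]; [now right|].
  exfalso.
  destruct (adjoin p Hp Np) as (g & n & Hg & Hg1 & Hgc).
  destruct (adjoin q Hq Nq) as (h & m & Hh & Hh1 & Hhc).
  apply Hc, Fup with (mul g h); [now apply Fmul|].
  rewrite <- (mulx1 (mul g h)).
  rewrite <- (coprime_pow p (pow q m) n); auto using pow_neg.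
  - apply mul_join_le.
    + apply le_trans with (2 := Hgc). apply mul_ler. rewrite mulC. now apply mul_le_neg.
    + apply le_trans with (2 := Hhc). apply mul_ler. now apply mul_le_neg.
  - rewrite joinC. apply coprime_pow; auto. now rewrite joinC.
Qed.

Lemma maximal_filter_exists c :
  ~ le ue c ->
  exists F, filter F /\ ~ F c /\
  forall F', filter F' -> (forall x, F x -> F' x) -> ~ F' c -> forall x, F' x -> F x.
Proof.
  intros Hc.
  assert (Hprin : filter (fun x => le ue x)).
  { repeat split.
    - apply le_refl.
    - intros x y Hx Hy. now apply le_trans with x.
    - intros x y Hx Hy. rewrite <- (mul1 ue).
      apply le_trans with (mul ue y); [now apply mul_lel | now apply mul_ler].
    - intros x Hx. apply le_meet; [exact Hx | apply le_refl]. }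
  (* The empty set is admitted so that the union of the empty chain is covered. *)
  pose (P := fun F : A -> Prop => (forall x, ~ F x) \/ (filter F /\ ~ F c)).
  destruct (@classical_sets.Zorn_bigcup A P) as (F & HPF & Hmax).
  - intros Ch HCh Htot. unfold classical_sets.bigcup, classical_sets.mkset.
    destruct (classic (exists X x, Ch X /\ X x)) as [(X0 & x0 & HX0 & Hx0)|Hempty].
    + right.
      assert (Hfil : forall X x, Ch X -> X x -> filter X /\ ~ X c).
      { intros X x HX Hx. destruct (HCh X HX) as [HN|HN]; [|exact HN].
        now destruct (HN x). }
      split; [repeat split|].
      * exists X0; [exact HX0|]. now apply (Hfil X0 x0).
      * intros x y [X HX Hx] Hxy. exists X; [exact HX|].
        destruct (Hfil X x HX Hx) as ((_ & Fup & _) & _). now apply Fup with x.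
      * intros x y [X HX Hx] [Y HY Hy].
        destruct (Htot X Y HX HY) as [HXY|HYX].
        -- exists Y; [exact HY|].
           destruct (Hfil Y y HY Hy) as ((_ & _ & Fmul & _) & _).
           apply Fmul; [now apply HXY | exact Hy].
        -- exists X; [exact HX|].
           destruct (Hfil X x HX Hx) as ((_ & _ & Fmul & _) & _).
           apply Fmul; [exact Hx | now apply HYX].
      * intros x [X HX Hx]. exists X; [exact HX|].
        destruct (Hfil X x HX Hx) as ((_ & _ & _ & Fneg) & _). now apply Fneg.
      * intros [X HX Hx]. now apply (Hfil X c HX Hx).
    + left. intros x [X HX Hx]. apply Hempty. now exists X, x.
  - assert (Hext : forall F', filter F' -> (forall x, F x -> F' x) -> ~ F' c ->
                    forall x, F' x -> F x).
    { intros F' HF' Hsub HF'c.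
      destruct (classic (forall x, F' x -> F x)) as [|Hn]; [assumption|].
      exfalso. apply (Hmax F'); [split; assumption | now right]. }
    (* The maximal set is not empty, since the filter of all elements above the unit omits [c] and
       would extend it. *)
    destruct HPF as [HN|(HF & HFc)].
    + exfalso. apply (HN ue), (Hext _ Hprin); [|exact Hc|apply le_refl].
      intros x Hx. now destruct (HN x).
    + now exists F.
Qed.

(** Take a filter maximal among those omitting [imp a b]. It is prime, and the two joinands of
    [prelinear] lie below [imp y x] and [imp x y], which gives totality. *)
Lemma linear_preorder_separation a b :
  ~ le a b -> exists R, linear_preorder R /\ ~ R a b.
Proof.
  intros Hab. destruct (maximal_filter_exists (imp a b)) as (F & HF & Hc & Hmax).
  { now rewrite le_imp. }
  exists (fun x y => F (imp x y)). split; [|exact Hc].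
  apply filter_linear; [exact HF|]. intros x y.
  pose proof HF as (_ & Fup & _).
  destruct (maximal_filter_prime F _ _ _ HF Hc Hmax
              (meet_ler _ _) (meet_ler _ _) (prelinear x y)) as [H|H].
  - right. apply Fup with (1 := H).
    apply le_trans with (1 := meet_lel _ _). apply residuation.
    apply le_trans with (2 := imp_mul_le (join x y) x). apply mul_ler, le_joinr.
  - left. apply Fup with (1 := H).
    apply le_trans with (1 := meet_lel _ _). apply residuation.
    apply le_trans with (2 := imp_mul_le (join x y) y). apply mul_ler, le_joinl.
Qed.

End Residuated.

Arguments linear_preorder {A} R.
Arguments lp_le {A R} _.
Arguments lp_trans {A R} _.
Arguments lp_total {A R} _.
Arguments lp_res {A R} _.
Arguments lp_meet {A R} _.
Arguments lp_join {A R} _.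

Section LinearPreorder.

Variables (A : ULsig) (HA : is_UL A) (R : A -> A -> Prop) (HR : linear_preorder R).
Implicit Types x y z : A.

Lemma lp_refl x : R x x.
Proof. now apply (lp_le HR), le_refl. Qed.

Lemma lp_mull z x y : R x y -> R (mul z x) (mul z y).
Proof.
  intros H. apply (lp_res HR). apply (lp_trans HR) with (1 := H).
  apply (lp_res HR), lp_refl.
Qed.

Lemma lp_mulr z x y : R x y -> R (mul x z) (mul y z).
Proof. rewrite !(mulC A HA _ z). apply lp_mull. Qed.

End LinearPreorder.

(** * Monomials over a finite list and their supports *)

(** Exponent vectors are functions on all of [nat]; coordinates from [length G] on are ignored,
    which avoids a type of vectors of fixed length. *)
Fixpoint ev {A : ULsig} (G : list A) (v : nat -> nat) : A :=
  match G with
  | [] => ue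
  | g :: G' => mul (pow g (v 0)) (ev G' (fun i => v (S i)))
  end.

Definition vadd (v w : nat -> nat) : nat -> nat := fun i => v i + w i.

Definition vzero : nat -> nat := fun _ => 0.

Section Evaluation.

Variables (A : ULsig) (HA : is_UL A).
Implicit Types (G : list A) (v w : nat -> nat).

Lemma ev_add G v w : ev G (vadd v w) = mul (ev G v) (ev G w).
Proof.
  revert v w. induction G as [|g G IH]; simpl; intros v w.
  - now rewrite mul1.
  - change (fun i => vadd v w (S i))
      with (vadd (fun i => v (S i)) (fun i => w (S i))).
    unfold vadd at 1. now rewrite IH, (pow_add A HA), (mulACA A HA).
Qed.

Lemma ev_zero G : ev G vzero = ue.
Proof.
  induction G as [|g G IH]; simpl; [reflexivity|].
  rewrite (mul1 A HA). exact IH.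
Qed.

Lemma ev_generator G g : In g G -> exists v, ev G v = g.
Proof.
  induction G as [|h G IH]; intros Hg; [easy|].
  destruct Hg as [->|Hg].
  - exists (fun i => match i with 0 => 1 | S _ => 0 end). simpl.
    change (mul (mul g ue) (ev G vzero) = g).
    now rewrite ev_zero, !(mulx1 A HA).
  - destruct (IH Hg) as [v Hv].
    exists (fun i => match i with 0 => 0 | S j => v j end). simpl.
    rewrite (mul1 A HA). exact Hv.
Qed.

Lemma ev_ext G v w : (forall i, i < length G -> v i = w i) -> ev G v = ev G w.
Proof.
  revert v w. induction G as [|g G IH]; simpl; intros v w H; [reflexivity|].
  rewrite (H 0) by lia. f_equal. apply IH. intros i Hi. apply H. lia.
Qed.

Section Support.

Variables (R : A -> A -> Prop) (HR : linear_preorder R).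
Hypothesis omega : forall x : A, imp x ue = imp (mul x x) ue.

Lemma square_le_unit x y : R (mul (mul x x) y) ue <-> R (mul x y) ue.
Proof. now rewrite !(lp_res HR), (omega x). Qed.

Lemma pow_le_unit x y n : R (mul (pow x (S n)) y) ue <-> R (mul x y) ue.
Proof.
  revert y. induction n as [|n IH]; intros y.
  - simpl. now rewrite (mulx1 A HA).
  - change (pow x (S (S n))) with (mul x (pow x (S n))).
    rewrite <- (mulA A HA), (mulCA A HA), IH, (mulA A HA).
    apply square_le_unit.
Qed.

(** In a product compared with the unit, a positive power of a generator may be exchanged for any
    other positive power. The factor [y] collects the powers already exchanged. *)
Lemma ev_le_unit_support G v w y :
  (forall i, i < length G -> v i = 0 <-> w i = 0) ->
  R (mul (ev G v) y) ue -> R (mul (ev G w) y) ue.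
Proof.
  revert v w y. induction G as [|g G IH]; simpl; intros v w y Hsupp Hv; [exact Hv|].
  rewrite <- (mulA A HA) in Hv |- *.
  assert (H0 : v 0 = 0 <-> w 0 = 0) by (apply Hsupp; lia).
  assert (Hg : R (mul (pow g (w 0)) (mul (ev G (fun i => v (S i))) y)) ue).
  { destruct (v 0) as [|m], (w 0) as [|n]; try (exfalso; lia); [exact Hv|].
    apply <- pow_le_unit. now apply -> (pow_le_unit g (mul (ev G (fun i => v (S i))) y) m). }
  rewrite (mulCA A HA) in Hg |- *. revert Hg. apply IH.
  intros i Hi. apply Hsupp. lia.
Qed.

End Support.

End Evaluation.

(** * The algebra of closed sets of exponent vectors *)

Section Model.

Variables (A : ULsig) (R : A -> A -> Prop) (G : list A).
Implicit Types (v w k : nat -> nat) (P : (nat -> nat) -> Prop).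

(** The Galois closure for the relation between vectors [v] and tests [(k, b)]: the intersection of
    all basic sets containing [P]. *)
Definition closure P v : Prop :=
  forall k b, In b G ->
    (forall x, P x -> R (mul (ev G x) (ev G k)) b) -> R (mul (ev G v) (ev G k)) b.

Definition cset : Type := {P : (nat -> nat) -> Prop | forall v, closure P v -> P v}.

Definition mem (X : cset) v : Prop := proj1_sig X v.

Lemma closure_idem P v : closure (closure P) v -> closure P v.
Proof. intros H k b Hb HP. apply H; [exact Hb|]. intros x Hx. now apply Hx. Qed.

Definition cl P : cset := exist _ (closure P) (closure_idem P).

Definition down (a : A) : cset := cl (fun v => R (ev G v) a).

(** Wrapping every operation in [cl] supplies closedness uniformly. For meets, joins and residuals,
    and for [down a] with [a] in [G], the set turns out to be closed already. *)
Definition model : ULsig := {|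
  car := cset;
  meet X Y := cl (fun v => mem X v /\ mem Y v);
  join X Y := cl (fun v => mem X v \/ mem Y v);
  mul X Y := cl (fun v => exists x y, mem X x /\ mem Y y /\ v = vadd x y);
  imp X Y := cl (fun v => forall x, mem X x -> mem Y (vadd x v));
  ue := down ue;
  uf := down uf;
  ubot := cl (fun _ => False);
  utop := cl (fun _ => True)
|}.

Lemma closure_sub P v : P v -> closure P v.
Proof. intros Hv k b Hb H. now apply H. Qed.

Lemma mem_cl P : (forall v, closure P v -> P v) -> forall v, mem (cl P) v <-> P v.
Proof. intros H v. split; [apply H | apply closure_sub]. Qed.

Lemma cl_min P (X : cset) : (forall v, P v -> mem X v) -> forall v, mem (cl P) v -> mem X v.
Proof.
  intros HP v Hv. apply (proj2_sig X). intros k b Hb HX. apply Hv; [exact Hb|].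
  intros x Hx. now apply HX, HP.
Qed.

Lemma cset_ext (X Y : cset) : (forall v, mem X v <-> mem Y v) -> X = Y.
Proof.
  destruct X as [P HP], Y as [Q HQ]. unfold mem. simpl. intros H.
  assert (E : P = Q).
  { apply functional_extensionality. intros v. now apply propositional_extensionality. }
  subst Q. f_equal. apply proof_irrelevance.
Qed.

Lemma mem_meet (X Y : model) v : mem (meet X Y) v <-> mem X v /\ mem Y v.
Proof.
  apply mem_cl. clear v. intros v Hv.
  split; [apply (proj2_sig X) | apply (proj2_sig Y)];
    intros k b Hb H; (apply Hv; [exact Hb|]); intros x [Hx Hy]; now apply H.
Qed.

Lemma model_le (X Y : model) : le X Y <-> forall v, mem X v -> mem Y v.
Proof.
  unfold le. split.
  - intros <- v Hv. now apply mem_meet in Hv.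
  - intros H. apply cset_ext. intros v. rewrite mem_meet. firstorder.
Qed.

Lemma mem_top v : mem (@utop model) v.
Proof. now apply closure_sub. Qed.

Lemma bot_sub (X : model) v : mem (@ubot model) v -> mem X v.
Proof. now apply cl_min. Qed.

Lemma mem_mul (X Y : model) x y : mem X x -> mem Y y -> mem (mul X Y) (vadd x y).
Proof. intros Hx Hy. apply closure_sub. now exists x, y. Qed.

Lemma mul_sub (X Y Z : model) :
  (forall v, mem (mul X Y) v -> mem Z v) <->
  (forall x y, mem X x -> mem Y y -> mem Z (vadd x y)).
Proof.
  split.
  - intros H x y Hx Hy. now apply H, mem_mul.
  - intros H. apply cl_min. intros v (x & y & Hx & Hy & ->). now apply H.
Qed.

Hypotheses (HA : is_UL A) (HR : linear_preorder R).

(** The test [(k, b)] on [vadd x v] is the test [(vadd x k, b)] on [v], so the residual is an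
    intersection of basic sets. *)
Lemma mem_imp (X Y : model) v : mem (imp X Y) v <-> forall x, mem X x -> mem Y (vadd x v).
Proof.
  apply mem_cl. clear v. intros v Hv x Hx.
  apply (proj2_sig Y). intros k b Hb HY.
  rewrite (ev_add A HA), (mulC A HA (ev G x)), <- (mulA A HA), <- (ev_add A HA).
  apply Hv; [exact Hb|]. intros p Hp.
  rewrite (ev_add A HA), (mulA A HA), (mulC A HA _ (ev G x)), <- (ev_add A HA).
  now apply HY, Hp.
Qed.

(** This set is basic: its test is [(vzero, a)]. *)
Lemma mem_down a v : In a G -> mem (down a) v <-> R (ev G v) a.
Proof.
  intros Ha. apply mem_cl. clear v. intros v Hv.
  rewrite <- (mulx1 A HA (ev G v)), <- (ev_zero A HA G). apply Hv; [exact Ha|].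
  intros x Hx. now rewrite (ev_zero A HA), (mulx1 A HA).
Qed.

Lemma mem_lower (X : model) v w : mem X v -> R (ev G w) (ev G v) -> mem X w.
Proof.
  intros Hv Hwv. apply (proj2_sig X). intros k b _ HX.
  apply (lp_trans HR) with (2 := HX v Hv). now apply lp_mulr.
Qed.

Lemma mem_eq (X : model) v w : mem X v -> ev G w = ev G v -> mem X w.
Proof.
  intros Hv E. apply mem_lower with (1 := Hv). rewrite E. now apply lp_refl.
Qed.

(** Closed sets are down-sets of a total preorder on vectors, hence form a chain; in particular a
    union of two is one of them. *)
Lemma model_total (X Y : model) :
  (forall v, mem X v -> mem Y v) \/ (forall v, mem Y v -> mem X v).
Proof.
  destruct (classic (forall v, mem X v -> mem Y v)) as [|H]; [now left|right].
  apply not_all_ex_not in H as [v H]. apply imply_to_and in H as [HX HY].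
  intros w Hw. destruct (lp_total HR (ev G w) (ev G v)) as [H|H].
  - now apply mem_lower with v.
  - now destruct HY; apply mem_lower with w.
Qed.

Lemma mem_join (X Y : model) v : mem (join X Y) v <-> mem X v \/ mem Y v.
Proof.
  apply mem_cl. clear v. intros v Hv.
  destruct (model_total X Y) as [H|H]; [right|left];
    revert v Hv; apply cl_min; intros v [Hv|Hv]; auto.
Qed.

Hypothesis Ge : In ue G.

Lemma model_mulC (X Y : model) : mul X Y = mul Y X.
Proof.
  enough (H : forall X Y : model, forall v, mem (mul X Y) v -> mem (mul Y X) v)
    by (apply cset_ext; split; apply H).
  clear X Y. intros X Y. apply mul_sub. intros x y Hx Hy.
  apply mem_eq with (vadd y x); [now apply mem_mul|].
  rewrite !(ev_add A HA). apply (mulC A HA).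
Qed.

(** The closure inside [mul Y Z] may be dropped because [imp X W] is itself closed. *)
Lemma mul3_sub (X Y Z W : model) :
  (forall v, mem (mul X (mul Y Z)) v -> mem W v) <->
  (forall x y z, mem X x -> mem Y y -> mem Z z -> mem W (vadd x (vadd y z))).
Proof.
  rewrite mul_sub. split.
  - intros H x y z Hx Hy Hz. apply H; [exact Hx | now apply mem_mul].
  - intros H x u Hx. revert u.
    assert (HW : forall u, mem (mul Y Z) u -> mem (imp X W) u).
    { apply mul_sub. intros y z Hy Hz. apply mem_imp. auto. }
    intros u Hu. specialize (HW u Hu). rewrite mem_imp in HW. auto.
Qed.

Lemma model_mulA (X Y Z : model) : mul X (mul Y Z) = mul (mul X Y) Z.
Proof.
  apply cset_ext. intros v. split; revert v.
  - apply mul3_sub. intros x y z Hx Hy Hz.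
    apply mem_eq with (vadd (vadd x y) z); [now repeat apply mem_mul|].
    rewrite !(ev_add A HA). apply (mulA A HA).
  - rewrite (model_mulC (mul X Y) Z). apply mul3_sub. intros z x y Hz Hx Hy.
    apply mem_eq with (vadd x (vadd y z)); [now repeat apply mem_mul|].
    rewrite !(ev_add A HA). rewrite (mulC A HA (ev G z)). symmetry. apply (mulA A HA).
Qed.

Lemma model_mul1 (X : model) : mul ue X = X.
Proof.
  apply cset_ext. intros v. split; [revert v; apply mul_sub|].
  - intros u x Hu Hx. apply mem_down in Hu; [|exact Ge].
    apply mem_lower with (1 := Hx).
    rewrite (ev_add A HA). rewrite <- (mul1 A HA (ev G x)) at 2. now apply lp_mulr.
  - intros Hv. apply mem_eq with (vadd vzero v).
    + apply mem_mul; [|exact Hv]. apply mem_down; [exact Ge|].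
      rewrite (ev_zero A HA). now apply lp_refl.
    + now rewrite (ev_add A HA), (ev_zero A HA), (mul1 A HA).
Qed.

Lemma model_residuation (X Y Z : model) : le (mul X Y) Z <-> le Y (imp X Z).
Proof.
  rewrite !model_le, mul_sub. split.
  - intros H y Hy. apply mem_imp. auto.
  - intros H x y Hx Hy. specialize (H y Hy). rewrite mem_imp in H. auto.
Qed.

(** Such an [X] contains the unit of the model, so [mul X U] contains [U]. By totality one joinand
    of the semilinearity identity is always of this kind. *)
Lemma model_lam (U X : model) : mem X vzero -> lam U X = ue.
Proof.
  intros HX. apply cset_ext. intros v. unfold lam. rewrite mem_meet.
  split; [tauto|]. intros Hv. split; [|exact Hv].
  apply mem_imp. intros u Hu. apply mem_lower with (vadd vzero u).
  - now apply mem_mul.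
  - apply mem_down in Hv; [|exact Ge].
    rewrite !(ev_add A HA), (ev_zero A HA), (mulC A HA). now apply lp_mulr.
Qed.

Lemma model_is_UL : is_UL model.
Proof.
  assert (one : forall X Y : model, (forall v, mem X v -> mem Y v) -> mem (imp X Y) vzero).
  { intros X Y H. apply mem_imp. intros x Hx. apply H.
    apply mem_eq with (1 := Hx). now rewrite (ev_add A HA), (ev_zero A HA), (mulx1 A HA). }
  repeat apply conj.
  - intros X Y Z. apply cset_ext. intros v. rewrite !mem_meet. tauto.
  - intros X Y Z. apply cset_ext. intros v. rewrite !mem_join. tauto.
  - intros X Y. apply cset_ext. intros v. rewrite !mem_meet. tauto.
  - intros X Y. apply cset_ext. intros v. rewrite !mem_join. tauto.
  - intros X Y. apply cset_ext. intros v. rewrite mem_meet, mem_join. tauto.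
  - intros X Y. apply cset_ext. intros v. rewrite mem_join, mem_meet. tauto.
  - intros X. apply model_le. apply bot_sub.
  - intros X. apply model_le. intros v _. apply mem_top.
  - apply model_mulA.
  - apply model_mulC.
  - apply model_mul1.
  - apply model_residuation.
  - intros X Y U V. apply cset_ext. intros v. rewrite mem_join.
    destruct (model_total X Y) as [H|H].
    + rewrite (model_lam V).
      * unfold lam. rewrite mem_meet. tauto.
      * apply one. intros w. rewrite mem_join. firstorder.
    + rewrite (model_lam U).
      * unfold lam. rewrite mem_meet. tauto.
      * apply one. intros w. rewrite mem_join. firstorder.
Qed.

(** A mixed product x x' y is dominated by the one using the larger of x, x' twice, and squares
    compare with the unit as first powers do. *)
Lemma model_is_ULw : (forall x : A, imp x ue = imp (mul x x) ue) -> is_ULw model.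
Proof.
  intros omega. split; [apply model_is_UL|]. intros X.
  assert (H : forall Y : model, le Y (imp X ue) <-> le Y (imp (mul X X) ue)).
  { intros Y. rewrite <- !model_residuation, <- model_mulA, !model_le, mul3_sub, mul_sub.
    assert (Hsq : forall x y, mem (@ue model) (vadd x y) <->
                              mem (@ue model) (vadd x (vadd x y))).
    { intros x y. unfold ue, model. rewrite !mem_down by exact Ge.
      rewrite !(ev_add A HA), (mulA A HA). symmetry. exact (square_le_unit A R HR omega _ _). }
    split.
    - intros H x x' y Hx Hx' Hy.
      destruct (lp_total HR (ev G x) (ev G x')) as [Hle|Hle].
      + apply mem_lower with (vadd x' (vadd x' y)); [apply -> Hsq; now apply H|].
        rewrite !(ev_add A HA). now apply lp_mulr.
      + apply mem_lower with (vadd x (vadd x y)); [apply -> Hsq; now apply H|].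
        rewrite !(ev_add A HA). now apply lp_mull, lp_mulr.
    - intros H x y Hx Hy. apply <- Hsq. now apply H. }
  apply (le_antisym model model_is_UL); apply H, (le_refl model model_is_UL).
Qed.

(** Let the test [(k, b)] hold on [X] and let [w] evaluate to [neg b]. From b = [neg (neg b)] it
    follows that [vadd w k] lies in [neg X]. So a [v] in [neg (neg X)] satisfies v w k <= f, which
    is the test [(k, b)] for [v]. *)
Lemma model_involutive :
  In uf G -> (forall b, In b G -> In (neg b) G /\ neg (neg b) = b) ->
  forall X : model, neg (neg X) = X.
Proof.
  intros Gf Gneg X. apply cset_ext. intros v. unfold neg. rewrite mem_imp. split.
  - intros H. apply (proj2_sig X). intros k b Hb HX.
    destruct (Gneg b Hb) as [Hnb Hnn].
    destruct (ev_generator A HA G (neg b) Hnb) as [w Hw].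
    assert (Hf : mem (@uf model) (vadd (vadd w k) v)).
    { apply H, mem_imp. intros x Hx. apply mem_down; [exact Gf|].
      rewrite !(ev_add A HA), (mulCA A HA). apply (lp_res HR). rewrite Hw.
      change (R (mul (ev G x) (ev G k)) (neg (neg b))). rewrite Hnn. now apply HX. }
    apply mem_down in Hf; [|exact Gf].
    rewrite <- Hnn. apply -> (lp_res HR).
    rewrite !(ev_add A HA), Hw, <- (mulA A HA), (mulC A HA (ev G k)) in Hf. exact Hf.
  - intros Hv u Hu. rewrite mem_imp in Hu. apply mem_eq with (1 := Hu v Hv).
    rewrite !(ev_add A HA). apply (mulC A HA).
Qed.

Lemma mem_down_neg_le a b : In a G -> In b G -> ~ R a b -> ~ @le model (down a) (down b).
Proof.
  intros Ha Hb Hab. rewrite model_le. intros H. apply Hab.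
  destruct (ev_generator A HA G a Ha) as [v Hv].
  specialize (H v). rewrite !mem_down, Hv in H by assumption.
  apply H. now apply lp_refl.
Qed.

End Model.

(** * Finiteness *)

Definition increasing (phi : nat -> nat) : Prop := forall i j, i < j -> phi i < phi j.

Lemma increasing_step phi : (forall i, phi i < phi (S i)) -> increasing phi.
Proof.
  intros H i j Hij. induction Hij as [|j Hij IH]; [apply H|].
  specialize (H j). lia.
Qed.

(** Either from some [N] on every index has a later [S]-successor, and iteration gives a chain; or
    indices without later successors occur arbitrarily far out, and one lists those. *)
Lemma transitive_subsequence (S : nat -> nat -> Prop) :
  (forall i j k, S i j -> S j k -> S i k) ->
  exists phi, increasing phi /\
    ((forall i j, i < j -> S (phi i) (phi j)) \/ (forall i j, i < j -> ~ S (phi i) (phi j))).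
Proof.
  intros Htrans.
  (* The premise [N <= n] stands under [exists m] so that choice gives a total function, with
     arbitrary values below [N]. *)
  destruct (classic (exists N, forall n, exists m, N <= n -> n < m /\ S n m)) as [[N HN]|HN].
  - pose (f n := proj1_sig (constructive_indefinite_description _ (HN n))).
    assert (Hf : forall n, N <= n -> n < f n /\ S n (f n))
      by (intros n; exact (proj2_sig (constructive_indefinite_description _ (HN n)))).
    pose (phi i := Nat.iter i f N).
    assert (Hphi : forall i, N <= phi i).
    { induction i as [|i IH]; simpl; [lia|]. specialize (Hf _ IH). simpl in Hf. lia. }
    assert (Hstep : forall i, phi i < phi (1 + i) /\ S (phi i) (phi (1 + i)))
      by (intros i; apply Hf, Hphi).
    exists phi. split; [apply increasing_step; apply Hstep|]. left.
    intros i j Hij. induction Hij as [|j Hij IH]; [apply Hstep|].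
    apply Htrans with (1 := IH), Hstep.
  - assert (Hterm : forall N, exists n, N <= n /\ forall m, n < m -> ~ S n m).
    { intros N. apply NNPP. intros Hn. apply HN. exists N. intros n.
      destruct (classic (N <= n)) as [Hle|Hle]; [|exists 0; tauto].
      apply NNPP. intros Hm. apply Hn. exists n. split; [exact Hle|].
      intros m Hlt HS. apply Hm. exists m. tauto. }
    pose (g n := proj1_sig (constructive_indefinite_description _ (Hterm n))).
    assert (Hg : forall n, n <= g n /\ forall m, g n < m -> ~ S (g n) m)
      by (intros n; exact (proj2_sig (constructive_indefinite_description _ (Hterm n)))).
    pose (phi := fix phi i := match i with 0 => g 0 | Datatypes.S j => g (Datatypes.S (phi j)) end).
    assert (Hinc : increasing phi).
    { apply increasing_step. intros i. apply (Hg (Datatypes.S (phi i))). }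
    exists phi. split; [exact Hinc|]. right. intros i j Hij.
    assert (Hi : exists n, phi i = g n) by (destruct i; eexists; reflexivity).
    destruct Hi as [n Hn]. apply Hinc in Hij. rewrite Hn in *. now apply Hg.
Qed.

(** Thin out first to a strictly increasing or a nonincreasing sequence. Thin out the latter by
    equality: pairwise distinct terms would descend forever. *)
Lemma nat_subsequence (u : nat -> nat) :
  exists phi, increasing phi /\
    ((forall i j, u (phi i) = u (phi j)) \/ (forall i j, i < j -> u (phi i) < u (phi j))).
Proof.
  destruct (transitive_subsequence (fun i j => u i < u j)) as (phi & Hphi & [Hlt|Hge]).
  - intros i j k. lia.
  - exists phi. auto.
  - destruct (transitive_subsequence (fun i j => u (phi i) = u (phi j)))
      as (psi & Hpsi & [Heq|Hne]).
    + congruence.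
    + exists (fun i => phi (psi i)). split; [intros i j H; now apply Hphi, Hpsi|].
      left. intros i j. destruct (lt_eq_lt_dec i j) as [[H|H]|H].
      * now apply Heq.
      * now subst j.
      * symmetry. now apply Heq.
    + exfalso.
      assert (Hdesc : forall i, u (phi (psi i)) + i <= u (phi (psi 0))).
      { induction i as [|i IH]; [lia|].
        assert (Hi : psi i < psi (S i)) by (apply Hpsi; lia).
        specialize (Hge _ _ Hi). specialize (Hne i (S i) ltac:(lia)). lia. }
      specialize (Hdesc (S (u (phi (psi 0))))). lia.
Qed.

(** Treat one coordinate at a time; both alternatives survive further thinning. *)
Lemma family_subsequence n (u : nat -> nat -> nat) :
  exists phi, increasing phi /\
    forall c, c < n ->
      (forall i j, u c (phi i) = u c (phi j)) \/ (forall i j, i < j -> u c (phi i) < u c (phi j)).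
Proof.
  induction n as [|n (phi & Hphi & IH)].
  - exists (fun i => i). split; [intros i j; auto|]. intros c Hc. lia.
  - destruct (nat_subsequence (fun i => u n (phi i))) as (psi & Hpsi & Hn).
    exists (fun i => phi (psi i)). split; [intros i j H; now apply Hphi, Hpsi|].
    intros c Hc. destruct (Nat.eq_dec c n) as [->|Hcn]; [exact Hn|].
    destruct (IH c ltac:(lia)) as [H|H]; [left|right]; auto.
Qed.

(** Each term is chosen against [prefix n], the list of the terms before it. *)
Lemma infinite_sequence (T : Type) (E : T -> T -> Prop) :
  ~ (exists L, forall x, exists y, In y L /\ E x y) ->
  exists u : nat -> T, forall i j, i < j -> ~ E (u j) (u i).
Proof.
  intros HL.
  assert (Hnew : forall L, exists x, forall y, In y L -> ~ E x y).
  { intros L. apply NNPP. intros Hn. apply HL. exists L. intros x.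
    apply NNPP. intros Hx. apply Hn. exists x. intros y Hy HE. apply Hx. now exists y. }
  pose (new L := proj1_sig (constructive_indefinite_description _ (Hnew L))).
  assert (Hspec : forall L y, In y L -> ~ E (new L) y)
    by (intros L; exact (proj2_sig (constructive_indefinite_description _ (Hnew L)))).
  pose (prefix := fix prefix n := match n with 0 => [] | S m => new (prefix m) :: prefix m end).
  exists (fun n => new (prefix n)). intros i j Hij. apply Hspec.
  induction Hij as [|j Hij IH]; simpl; auto.
Qed.

Lemma sublists (T : Type) (P : list T) :
  exists LL : list (list T), forall S : T -> Prop,
    exists Q, In Q LL /\ forall x, In x Q <-> In x P /\ S x.
Proof.
  induction P as [|p P [LL IH]].
  - exists [[]]. intros S. exists []. simpl. tauto.
  - exists (LL ++ map (cons p) LL). intros S. destruct (IH S) as (Q & HQ & HS).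
    destruct (classic (S p)) as [Hp|Hp].
    + exists (p :: Q). split; [apply in_or_app; right; now apply in_map|].
      intros x. simpl. rewrite HS. intuition congruence.
    + exists Q. split; [apply in_or_app; now left|].
      intros x. rewrite HS. simpl. intuition congruence.
Qed.

(** * Finitely many basic sets, hence finitely many closed sets *)

Section Finiteness.

Variables (A : ULsig) (HA : is_UL A) (R : A -> A -> Prop) (HR : linear_preorder R).
Variable (G : list A).
Hypothesis omega : forall x : A, imp x ue = imp (mul x x) ue.

(* [M 1 + K 2 = (M 0 + K 0) + p] and [M 2 + K 2 = (M 0 + K 1) + q] with [p] and
   [q] of equal support, hence on the same side of the unit. *)
Lemma no_alternation (K M : nat -> nat -> nat) (b : A) :
  (forall c, c < length G ->
     (K 0 c = K 1 c /\ K 1 c = K 2 c) \/ (K 0 c < K 1 c /\ K 1 c < K 2 c)) ->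
  (forall c, c < length G ->
     (M 0 c = M 1 c /\ M 1 c = M 2 c) \/ (M 0 c < M 1 c /\ M 1 c < M 2 c)) ->
  let t i j := R (mul (ev G (M j)) (ev G (K i))) b in
  (t 0 0 -> t 2 2 -> t 2 1 \/ t 1 0) /\ (t 2 1 -> t 1 0 -> t 0 0 \/ t 2 2).
Proof.
  intros HK HM t.
  pose (p c := (K 2 c - K 0 c) + (M 1 c - M 0 c)).
  pose (q c := (K 2 c - K 1 c) + (M 2 c - M 0 c)).
  assert (Ep : mul (ev G (M 1)) (ev G (K 2)) = mul (mul (ev G (M 0)) (ev G (K 0))) (ev G p)).
  { rewrite <- !(ev_add A HA). apply ev_ext. intros c Hc. unfold vadd, p.
    specialize (HK c Hc). specialize (HM c Hc). lia. }
  assert (Eq : mul (ev G (M 2)) (ev G (K 2)) = mul (mul (ev G (M 0)) (ev G (K 1))) (ev G q)).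
  { rewrite <- !(ev_add A HA). apply ev_ext. intros c Hc. unfold vadd, q.
    specialize (HK c Hc). specialize (HM c Hc). lia. }
  (* Each of [p] and [q] vanishes exactly at the coordinates where both [K] and [M] are constant. *)
  assert (Hpq : R (ev G p) ue -> R (ev G q) ue).
  { rewrite <- (mulx1 A HA (ev G p)), <- (mulx1 A HA (ev G q)).
    apply (ev_le_unit_support A HA R HR omega).
    intros c Hc. unfold p, q. specialize (HK c Hc). specialize (HM c Hc). lia. }
  assert (dec : forall x y z, R x ue -> R y z -> R (mul y x) z).
  { intros x y z Hx Hy. apply (lp_trans HR) with (2 := Hy).
    rewrite <- (mulx1 A HA y) at 2. now apply lp_mull. }
  assert (inc : forall x y z, R ue x -> R (mul y x) z -> R y z).
  { intros x y z Hx Hy. apply (lp_trans HR) with (2 := Hy).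
    rewrite <- (mulx1 A HA y) at 1. now apply lp_mull. }
  unfold t. rewrite Ep, Eq.
  (* If [p] and [q] evaluate below the unit, multiplying by them keeps a product below [b]; if both
     evaluate above it, removing them does. *)
  destruct (classic (R (ev G p) ue)) as [Hp|Hp].
  - split; intros H1 H2; [left|right]; auto.
  - assert (Hp' : R ue (ev G p)) by (destruct (lp_total HR (ev G p) ue); tauto).
    split; intros H1 H2; [|left; now apply inc with (ev G p)].
    destruct (classic (R (ev G q) ue)) as [Hq|Hq].
    + exfalso. apply Hp. revert Hq.
      rewrite <- (mulx1 A HA (ev G p)), <- (mulx1 A HA (ev G q)).
      apply (ev_le_unit_support A HA R HR omega).
      intros c Hc. unfold p, q. specialize (HK c Hc). specialize (HM c Hc). lia.
    + right. apply inc with (2 := H2). destruct (lp_total HR (ev G q) ue); tauto.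
Qed.

Lemma finite_traces (b : A) :
  exists L, forall k, exists w, In w L /\
    forall v, R (mul (ev G v) (ev G k)) b <-> R (mul (ev G v) (ev G w)) b.
Proof.
  pose (T k v := R (mul (ev G v) (ev G k)) b).
  apply NNPP. intros Hinf.
  destruct (infinite_sequence _ (fun k w => forall v, T k v <-> T w v) Hinf) as [k Hk].
  clear Hinf.
  assert (Htot : forall i j, (forall v, T i v -> T j v) \/ (forall v, T j v -> T i v)).
  { intros i j. destruct (classic (forall v, T i v -> T j v)) as [|H]; [now left|right].
    apply not_all_ex_not in H as [v H]. apply imply_to_and in H as [Hi Hj].
    intros w Hw. unfold T in *. destruct (lp_total HR (ev G w) (ev G v)) as [H|H].
    - apply (lp_trans HR) with (2 := Hi). now apply lp_mulr.
    - destruct Hj. apply (lp_trans HR) with (2 := Hw). now apply lp_mulr. }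
  assert (Hkm : exists K M : nat -> nat -> nat,
            (forall i j, T (K j) (M i) <-> j <= i) \/ (forall i j, T (K j) (M i) <-> i < j)).
  { destruct (transitive_subsequence (fun i j => forall v, T (k i) v -> T (k j) v))
      as (phi & Hphi & [Hup|Hdown]); [auto | |].
    (* Consecutive traces are nested and, by [Hk], distinct, so some vector separates them. *)
    - assert (Hm : forall i, exists m, T (k (phi (S i))) m /\ ~ T (k (phi i)) m).
      { intros i. apply NNPP. intros Hn.
        apply (Hk (phi i) (phi (S i))); [apply Hphi; lia|]. intros v. split.
        - intros H. apply NNPP. intros H'. apply Hn. now exists v.
        - apply Hup. lia. }
      pose (m i := proj1_sig (constructive_indefinite_description _ (Hm i))).
      assert (Hspec : forall i, T (k (phi (S i))) (m i) /\ ~ T (k (phi i)) (m i))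
        by (intros i; exact (proj2_sig (constructive_indefinite_description _ (Hm i)))).
      exists (fun i => k (phi i)), m. right. intros i j. split.
      + intros H. apply NNPP. intros Hij. apply (Hspec i).
        destruct (Nat.eq_dec j i) as [->|Hne]; [exact H|].
        revert H. apply Hup. lia.
      + intros Hij. destruct (Nat.eq_dec j (S i)) as [->|Hne]; [apply Hspec|].
        apply (Hup (S i) j); [lia | apply Hspec].
    (* Traces are comparable, so where an inclusion fails the reverse one holds. *)
    - assert (Hdown' : forall i j, i <= j -> forall v, T (k (phi j)) v -> T (k (phi i)) v).
      { intros i j Hij v Hv. destruct (Nat.eq_dec i j) as [->|Hne]; [exact Hv|].
        destruct (Htot (k (phi i)) (k (phi j))) as [H|H]; [|now apply H].
        now destruct (Hdown i j ltac:(lia)). }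
      assert (Hm : forall i, exists m, T (k (phi i)) m /\ ~ T (k (phi (S i))) m).
      { intros i. apply NNPP. intros Hn. apply (Hdown i (S i) ltac:(lia)).
        intros v H. apply NNPP. intros H'. apply Hn. now exists v. }
      pose (m i := proj1_sig (constructive_indefinite_description _ (Hm i))).
      assert (Hspec : forall i, T (k (phi i)) (m i) /\ ~ T (k (phi (S i))) (m i))
        by (intros i; exact (proj2_sig (constructive_indefinite_description _ (Hm i)))).
      exists (fun i => k (phi i)), m. left. intros i j. split.
      + intros H. apply NNPP. intros Hij. apply (Hspec i).
        revert H. apply Hdown'. lia.
      + intros Hij. apply (Hdown' j i Hij), Hspec. }
  destruct Hkm as (K & M & HKM).
  (* The coordinates of [K] and of [M] are put into one family so that a single [phi] serves
     both. *)
  destruct (family_subsequence (length G + length G)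
              (fun c i => if c <? length G then K i c else M i (c - length G)))
    as (phi & Hphi & Hc).
  pose proof (Hphi 0 1 ltac:(lia)) as H01. pose proof (Hphi 1 2 ltac:(lia)) as H12.
  destruct (no_alternation (fun i => K (phi i)) (fun i => M (phi i)) b) as [N1 N2].
  - intros c Hlt. specialize (Hc c ltac:(lia)). simpl in Hc.
    rewrite (proj2 (Nat.ltb_lt _ _) Hlt) in Hc.
    destruct Hc as [H|H]; [left|right]; split; apply H; lia.
  - intros c Hlt. specialize (Hc (length G + c) ltac:(lia)). simpl in Hc.
    replace (length G + c <? length G) with false in Hc by (symmetry; apply Nat.ltb_ge; lia).
    replace (length G + c - length G) with c in Hc by lia.
    destruct Hc as [H|H]; [left|right]; split; apply H; lia.
  (* In the pattern j <= i the pairs (0,0), (2,2) hold while (2,1), (1,0) fail, against [N1]; in the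
     pattern i < j it is the reverse, against [N2]. *)
  - fold (T (K (phi 0)) (M (phi 0))) (T (K (phi 2)) (M (phi 2)))
         (T (K (phi 2)) (M (phi 1))) (T (K (phi 1)) (M (phi 0))) in N1, N2.
    destruct HKM as [H|H]; rewrite !H in N1, N2; lia.
Qed.

(** A closed set is the intersection of the basic sets containing it. Finitely many pairs [(w, b)]
    represent all basic sets, and the subsets of these pairs are enumerated. *)
Lemma model_finite : finite_alg (model A R G).
Proof.
  assert (Hbasis : forall D : list A, exists P, forall k b, In b D ->
            exists w, In (w, b) P /\
              forall v, R (mul (ev G v) (ev G k)) b <-> R (mul (ev G v) (ev G w)) b).
  { induction D as [|d D [P IH]].
    - now exists [].
    - destruct (finite_traces d) as [L HL].
      exists (map (fun w => (w, d)) L ++ P). intros k b [<-|Hb].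
      + destruct (HL k) as (w & Hw & Ht). exists w. split; [|exact Ht].
        apply in_or_app. left. now apply (in_map (fun w => (w, d))).
      + destruct (IH k b Hb) as (w & Hw & Ht). exists w. split; [|exact Ht].
        apply in_or_app. now right. }
  destruct (Hbasis G) as [P HP]. destruct (sublists _ P) as [LL HLL].
  exists (map (fun Q => cl A R G (fun v => forall w b, In (w, b) Q ->
                                   R (mul (ev G v) (ev G w)) b)) LL).
  intros X.
  destruct (HLL (fun p => forall x, mem A R G X x -> R (mul (ev G x) (ev G (fst p))) (snd p)))
    as (Q & HQ & HX).
  apply in_map_iff. exists Q. split; [|exact HQ].
  apply cset_ext. intros v. split.
  - intros Hv. apply (proj2_sig X). intros k b Hb Hk.
    destruct (HP k b Hb) as (w & Hw & Ht). apply Hv; [exact Hb|].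
    intros x Hx. apply Ht, Hx, HX. split; [exact Hw|].
    intros y Hy. apply Ht. now apply Hk.
  - intros Hv. apply closure_sub. intros w b Hwb. apply HX in Hwb as [_ H]. now apply H.
Qed.

End Finiteness.

(** * Separation by finite products *)

(** The clauses of [partial_embedding] on operations. They pass to products, while reflection of the
    order is arranged pair by pair. *)
Definition partial_hom (A : ULsig) (B : list A) (C : ULsig) (iota : A -> C) : Prop :=
  (forall a b, In a B -> In b B -> In (meet a b) B -> iota (meet a b) = meet (iota a) (iota b)) /\
  (forall a b, In a B -> In b B -> In (join a b) B -> iota (join a b) = join (iota a) (iota b)) /\
  (forall a b, In a B -> In b B -> In (mul a b) B -> iota (mul a b) = mul (iota a) (iota b)) /\
  (forall a b, In a B -> In b B -> In (imp a b) B -> iota (imp a b) = imp (iota a) (iota b)) /\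
  (In (@ue A) B -> iota ue = ue) /\
  (In (@uf A) B -> iota uf = uf) /\
  (In (@ubot A) B -> iota ubot = ubot) /\
  (In (@utop A) B -> iota utop = utop).

(** If a <= b then the meet of a and b is a, which lies in [B], so the order is preserved;
    injectivity follows by antisymmetry. *)
Lemma partial_hom_embedding (A : ULsig) (HA : is_UL A) (B : list A) (C : ULsig) (iota : A -> C) :
  partial_hom A B C iota ->
  (forall a b, In a B -> In b B -> ~ le a b -> ~ le (iota a) (iota b)) ->
  is_UL C -> partial_embedding A B C iota.
Proof.
  intros Hhom Hrefl HC.
  assert (Hle : forall a b, In a B -> In b B -> le a b <-> le (iota a) (iota b)).
  { intros a b Ha Hb. split.
    - unfold le. intros H. rewrite <- (proj1 Hhom a b Ha Hb); now rewrite H.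
    - intros H. apply NNPP. intros Hn. now apply (Hrefl a b). }
  split; [|now split].
  intros a b Ha Hb E.
  apply (le_antisym A HA); apply Hle; auto; rewrite E; apply (le_refl C HC).
Qed.

(** Each [a] in [G] is the value of some vector, which is then a largest member of [down a]. Testing
    on it settles products and residuals. *)
Lemma down_partial_hom (A : ULsig) (HA : is_UL A) (R : A -> A -> Prop)
    (HR : linear_preorder R) (G : list A) :
  In ue G -> In ubot G -> partial_hom A G (model A R G) (down A R G).
Proof.
  intros Ge Gbot.
  repeat apply conj; try reflexivity.
  - intros a b Ha Hb Hab. apply cset_ext. intros v.
    rewrite mem_meet, !mem_down by assumption. split.
    + intros H. split; apply (lp_trans HR) with (1 := H), (lp_le HR);
        [now apply meet_lel | now apply meet_ler].
    + intros [H1 H2]. now apply (lp_meet HR).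
  - intros a b Ha Hb Hab. apply cset_ext. intros v.
    rewrite mem_join, !mem_down by assumption. split.
    + intros H. destruct (lp_total HR a b) as [Hle|Hle]; [right|left];
        apply (lp_trans HR) with (1 := H); apply (lp_join HR); first [assumption | now apply lp_refl].
    + intros [H|H]; apply (lp_trans HR) with (1 := H); apply (lp_le HR);
        [now apply le_joinl | now apply le_joinr].
  - intros a b Ha Hb Hab. apply cset_ext. intros v. split; revert v.
    + intros v Hv. apply mem_down in Hv; try assumption.
      destruct (ev_generator A HA G a Ha) as [x Hx], (ev_generator A HA G b Hb) as [y Hy].
      apply (mem_lower A R G HA HR _ (vadd x y)).
      * apply mem_mul; apply mem_down; auto; [rewrite Hx | rewrite Hy]; now apply lp_refl.
      * now rewrite (ev_add A HA), Hx, Hy.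
    + apply mul_sub. intros x y Hx Hy. apply mem_down in Hx, Hy; try assumption.
      apply mem_down; try assumption. rewrite (ev_add A HA).
      apply (lp_trans HR) with (mul a (ev G y)); [now apply lp_mulr | now apply lp_mull].
  - intros a b Ha Hb Hab. apply cset_ext. intros v.
    rewrite mem_imp, mem_down by assumption. split.
    + intros Hv x Hx. apply mem_down in Hx; try assumption. apply mem_down; try assumption.
      rewrite (ev_add A HA). apply (lp_trans HR) with (mul a (ev G v)); [now apply lp_mulr|].
      now apply (lp_res HR).
    + intros H. apply -> (lp_res HR).
      destruct (ev_generator A HA G a Ha) as [x Hx].
      specialize (H x). rewrite !mem_down, (ev_add A HA), Hx in H by assumption.
      apply H. now apply lp_refl.
  - intros _. apply cset_ext. intros v. split; [|apply bot_sub].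
    (* The least closed set is the intersection of all basic sets, and [mul ubot (ev G k)] is below
       every [b]. *)
    intros Hv k b Hb _. apply mem_down in Hv; try assumption.
    apply (lp_trans HR) with (mul ubot (ev G k)); [now apply lp_mulr|].
    rewrite (mulC A HA). apply (lp_res HR), (lp_le HR), (bot_le A HA).
  - intros Gtop. apply cset_ext. intros v. split; [intros; apply mem_top|].
    intros _. apply mem_down; try assumption. apply (lp_le HR), (le_top A HA).
Qed.

Definition prod_alg (C D : ULsig) : ULsig := {|
  car := C * D;
  meet x y := (meet (fst x) (fst y), meet (snd x) (snd y));
  join x y := (join (fst x) (fst y), join (snd x) (snd y));
  mul x y := (mul (fst x) (fst y), mul (snd x) (snd y));
  imp x y := (imp (fst x) (fst y), imp (snd x) (snd y));
  ue := (ue, ue);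
  uf := (uf, uf);
  ubot := (ubot, ubot);
  utop := (utop, utop)
|}.

Definition unit_alg : ULsig := {|
  car := unit;
  meet _ _ := tt; join _ _ := tt; mul _ _ := tt; imp _ _ := tt;
  ue := tt; uf := tt; ubot := tt; utop := tt
|}.

Lemma prod_le (C D : ULsig) (x y : prod_alg C D) :
  le x y <-> le (fst x) (fst y) /\ le (snd x) (snd y).
Proof.
  destruct x, y. unfold le. simpl. split.
  - now intros [= -> ->].
  - now intros [-> ->].
Qed.

Lemma prod_is_UL (C D : ULsig) : is_UL C -> is_UL D -> is_UL (prod_alg C D).
Proof.
  intros HC HD.
  destruct HC as (C1 & C2 & C3 & C4 & C5 & C6 & C7 & C8 & C9 & C10 & C11 & C12 & C13).
  destruct HD as (D1 & D2 & D3 & D4 & D5 & D6 & D7 & D8 & D9 & D10 & D11 & D12 & D13).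
  repeat apply conj.
  9-11, 1-6: intros; repeat match goal with x : car (prod_alg _ _) |- _ => destruct x end;
     simpl; f_equal; auto.
  - intros x. apply prod_le. split; [apply C7 | apply D7].
  - intros x. apply prod_le. split; [apply C8 | apply D8].
  - intros x y z. rewrite !prod_le. simpl. now rewrite C12, D12.
  - intros [x x'] [y y'] [u u'] [v v']. unfold lam in *. simpl. f_equal; auto.
Qed.

Lemma prod_is_ULw (C D : ULsig) : is_ULw C -> is_ULw D -> is_ULw (prod_alg C D).
Proof.
  intros [HC Cw] [HD Dw]. split; [now apply prod_is_UL|].
  intros [x x']. simpl. f_equal; auto.
Qed.

Lemma prod_is_IULw (C D : ULsig) : is_IULw C -> is_IULw D -> is_IULw (prod_alg C D).
Proof.
  intros [HC Cn] [HD Dn]. split; [now apply prod_is_ULw|].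
  intros [x x']. unfold neg in *. simpl. f_equal; auto.
Qed.

Lemma unit_is_IULw : is_IULw unit_alg.
Proof.
  repeat split; intros; repeat match goal with x : car unit_alg |- _ => destruct x end; reflexivity.
Qed.

Lemma prod_finite (C D : ULsig) : finite_alg C -> finite_alg D -> finite_alg (prod_alg C D).
Proof.
  intros [l Hl] [m Hm]. exists (list_prod l m). intros [x y]. now apply in_prod.
Qed.

Lemma partial_hom_pair (A : ULsig) (B : list A) (C D : ULsig) (i : A -> C) (j : A -> D) :
  partial_hom A B C i -> partial_hom A B D j ->
  partial_hom A B (prod_alg C D) (fun a => (i a, j a)).
Proof.
  intros (C1 & C2 & C3 & C4 & C5 & C6 & C7 & C8) (D1 & D2 & D3 & D4 & D5 & D6 & D7 & D8).
  repeat apply conj; intros; simpl; f_equal; auto.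
Qed.

(** Induction on a list of pairs multiplies in one separating factor per pair, starting from the
    empty product [unit_alg]. *)
Lemma FEP_of_separation (K : ULsig -> Prop) :
  (forall A, K A -> is_UL A) -> K unit_alg ->
  (forall C D, K C -> K D -> K (prod_alg C D)) ->
  (forall A, K A -> forall (B : list A) (a b : A), In a B -> In b B -> ~ le a b ->
     exists C, K C /\ finite_alg C /\
       exists iota, partial_hom A B C iota /\ ~ le (iota a) (iota b)) ->
  FEP K.
Proof.
  intros KUL Kunit Kprod Ksep A HA B _.
  assert (H : forall P : list (A * A), (forall p, In p P -> In (fst p) B /\ In (snd p) B) ->
            exists C, K C /\ finite_alg C /\ exists iota, partial_hom A B C iota /\
              forall a b, In (a, b) P -> ~ le a b -> ~ le (iota a) (iota b)).
  { induction P as [|[a b] P IH]; intros HP.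
    - exists unit_alg. split; [exact Kunit|]. split; [exists [tt]; intros []; now left|].
      exists (fun _ => tt). split; [now repeat split | easy].
    - destruct IH as (C & KC & FC & i & Hi & Sepi); [intros p Hp; apply HP; now right|].
      destruct (classic (le a b)) as [Hle|Hnle].
      + exists C. repeat (split; [assumption|]). exists i. split; [assumption|].
        intros c d [[= -> ->]|Hcd] Hn; [easy | now apply Sepi].
      + destruct (HP (a, b) (or_introl eq_refl)) as [Ha Hb].
        destruct (Ksep A HA B a b Ha Hb Hnle) as (D & KD & FD & j & Hj & Sepj).
        exists (prod_alg C D). split; [now apply Kprod|]. split; [now apply prod_finite|].
        exists (fun x => (i x, j x)). split; [now apply partial_hom_pair|].
        intros c d Hcd Hn. rewrite prod_le. simpl. intros [H1 H2].
        destruct Hcd as [[= -> ->]|Hcd]; [easy | now apply (Sepi c d)]. }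
  destruct (H (list_prod B B)) as (C & KC & FC & i & Hi & Sep).
  { intros [a b] Hab. now apply in_prod_iff in Hab. }
  exists C. repeat (split; [assumption|]). exists i.
  apply partial_hom_embedding; auto. intros a b Ha Hb. apply Sep. now apply in_prod.
Qed.

(** * The finite embeddability property of the two varieties *)

Lemma partial_hom_incl (A : ULsig) (B G : list A) (C : ULsig) (iota : A -> C) :
  incl B G -> partial_hom A G C iota -> partial_hom A B C iota.
Proof.
  intros HBG (C1 & C2 & C3 & C4 & C5 & C6 & C7 & C8). repeat apply conj; auto.
Qed.

Lemma ULw_separation (A : ULsig) (G : list A) (a b : A) :
  is_ULw A -> In ue G -> In ubot G -> In a G -> In b G -> ~ le a b ->
  exists R, linear_preorder R /\ is_ULw (model A R G) /\ finite_alg (model A R G) /\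
    partial_hom A G (model A R G) (down A R G) /\
    ~ le (down A R G a : model A R G) (down A R G b).
Proof.
  intros [HA omega] Ge Gbot Ha Hb Hab.
  destruct (linear_preorder_separation A HA a b Hab) as (R & HR & HRab).
  exists R. refine (conj HR (conj _ (conj _ (conj _ _)))).
  - now apply model_is_ULw.
  - now apply model_finite.
  - now apply down_partial_hom.
  - now apply mem_down_neg_le.
Qed.

Theorem theorem4p9 : FEP is_ULw /\ FEP is_IULw.
Proof.
  split; apply FEP_of_separation.
  - now intros A [].
  - apply unit_is_IULw.
  - apply prod_is_ULw.
  - intros A HA B a b Ha Hb Hab.
    (* Adding [ue] and [ubot] makes the unit of the model a basic set and identifies its bottom with
       [down ubot]. *)
    destruct (ULw_separation A (ue :: ubot :: B) a b) as (R & HR & Hw & Hfin & Hhom & Hsep);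
      simpl; auto.
    exists (model A R (ue :: ubot :: B)). repeat (split; [assumption|]).
    eexists. split; [|exact Hsep]. revert Hhom. apply partial_hom_incl.
    intros x Hx. simpl. auto.
  - now intros A [[]].
  - apply unit_is_IULw.
  - apply prod_is_IULw.
  - intros A HA B a b Ha Hb Hab.
    pose (B' := ue :: ubot :: uf :: B).
    assert (HB : incl B B') by (intros x Hx; unfold B'; simpl; auto).
    assert (HG : incl B' (B' ++ map neg B')) by (intros x Hx; apply in_or_app; now left).
    (* Since double negation is the identity, one round of negations already gives a list closed
       under [neg]. *)
    destruct (ULw_separation A (B' ++ map neg B') a b) as (R & HR & Hw & Hfin & Hhom & Hsep);
      [apply HA | apply HG; simpl; auto .. | exact Hab |].
    exists (model A R (B' ++ map neg B')). split; [|split; [assumption|]].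
    + split; [exact Hw|]. apply model_involutive; try apply HA; auto.
      * apply HG. simpl. auto.
      * intros x Hx. split; [|apply HA]. apply in_or_app.
        apply in_app_or in Hx as [Hx|Hx]; [right; now apply in_map|left].
        apply in_map_iff in Hx as (y & <- & Hy). now rewrite (proj2 HA).
    + eexists. split; [|exact Hsep]. revert Hhom. apply partial_hom_incl.
      intros x Hx. now apply HG, HB.
Qed.
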